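(* Suppose the graph $\mathcal{G} = (\mathcal{V},\mathcal{E})$ is connected, $\mathbf{Q} \in \mathbb{R}^{|\mathcal{E}| \times |\mathcal{V}|}$ is the incidence matrix of $\mathcal{G}$, and $T = \{\tau_1, \dots,\tau_d\}$ is a $(d,\alpha,\beta,r,R)$ row covering of $\mathbf{Q}$ with $\alpha>0$. Let $\mathbf{c}_0=\mathbf{c}\in\mathbb{R}^{|\mathcal{V}|}$ be the vector of initial node values, let $\mathbf{c}^*=\bar c\,\mathbf{1}$ where $\bar c$ is the mean of the entries of $\mathbf{c}$, and let $\mathbf{m}\in\mathbb{R}^{|\mathcal{E}|}$ be a fixed vector of edge miscommunication values. Let $\mathbf{c}_k$ be the iterates of the block gossip method under edge miscommunication $\mathbf{m}$ with blocks determined by $T$, i.e. $$\mathbf{c}_k = \mathbf{c}_{k-1} + \mathbf{Q}^\dagger_\tau(\mathbf{m}_\tau - \mathbf{Q}_\tau\mathbf{c}_{k-1}),$$ where at each iteration $\tau$ is chosen uniformly at random from $T$, independently of previous choices. Then the method converges at least linearly in expectation to a horizon determined by $\mathbf{m}$, with the guarantee, for all $k\ge0$, $$\mathbb{E}\|\mathbf{c}_k - \mathbf{c}^*\|^2 \le \left(1 - \frac{r\,\alpha(\mathcal{G})}{\beta d}\right)^k \|\mathbf{c} - \mathbf{c}^*\|^2 + \frac{\beta R}{\alpha\, r\, \alpha(\mathcal{G})}\|\mathbf{m}\|^2,$$ where $\alpha(\mathcal{G})$ is the algebraic connectivity of $\mathcal{G}$.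
   Context: $\mathcal{G}$ is a finite undirected graph. $[m]=\{1,\dots,m\}$, $\mathbf{1}$ is the all-ones vector, $\|\cdot\|$ is the Euclidean norm, $\dagger$ denotes the Moore–Penrose pseudoinverse, and $\mathbf{Q}_\tau$, $\mathbf{m}_\tau$ denote restriction to the rows (entries) indexed by $\tau$. Incidence matrix: each row of $\mathbf{Q}$ corresponds to an edge and each column to a node; the row of an edge joining nodes $i$ and $j$ has one of its $i$th and $j$th entries equal to $1$ and the other equal to $-1$ (order immaterial), all other entries zero. Row covering: a $(d,\alpha,\beta,r,R)$ row covering of a matrix $\mathbf{A}$ with $m$ rows is a collection $T=\{\tau_1,\dots,\tau_d\}$ of subsets of $[m]$ such that every $i \in [m]$ lies in some $\tau_l$, and $\alpha \le \lambda_{\min+}(\mathbf{A}_\tau\mathbf{A}_\tau^\top)$ and $\lambda_{\max}(\mathbf{A}_\tau\mathbf{A}_\tau^\top)\le\beta$ for each $\tau\in T$, where $\lambda_{\min+}$ and $\lambda_{\max}$ denote the smallest nonzero and the largest eigenvalue, and $r=\min_{i\in[m]}|\{\tau_l\in T: i\in\tau_l\}|$, $R=\max_{i\in[m]}|\{\tau_l\in T: i\in\tau_l\}|$. Algebraic connectivity $\alpha(\mathcal{G})$: the second smallest eigenvalue of the Laplacian $\mathbf{Q}^\top\mathbf{Q}$. (It is distinct from the covering parameter $\alpha$.) *)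

(* Defs.v *)
From HB Require Import structures.
From mathcomp Require Import all_boot all_order all_algebra.
From mathcomp Require Import polyrcf.
From mathcomp Require Import all_classical all_reals all_analysis.

Set Implicit Arguments.
Unset Strict Implicit.
Unset Printing Implicit Defensive.

Import Order.TTheory GRing.Theory Num.Theory.

Local Open Scope classical_set_scope.
Local Open Scope ring_scope.

(* MathComp-Analysis puts the sup norm on matrices, hence a separate name. *)
Definition enorm (R : realType) n (v : 'cV[R]_n) : R :=
  Num.sqrt (\sum_(i < n) v i 0 ^+ 2).

Definition mean (R : realType) n (v : 'cV[R]_n) : R :=
  (\sum_(i < n) v i 0) / n%:R.

(* Rows indexed by tau, in increasing order; for a column vector these are the
   entries indexed by tau. *)
Definition restrict (R : realType) m n (tau : {set 'I_m}) (A : 'M[R]_(m, n)) :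
  'M[R]_(#|tau|, n) := rowsub (fun k : 'I_#|tau| => enum_val k) A.

(* The four Penrose conditions. *)
Definition is_pseudoinverse (R : realType) m n
    (A : 'M[R]_(m, n)) (X : 'M[R]_(n, m)) : Prop :=
  [/\ A *m X *m A = A, X *m A *m X = X,
      (A *m X)^T = A *m X & (X *m A)^T = X *m A].

(* [pinvmx] of the library is only a one-sided partial inverse and is not the
   Moore-Penrose pseudoinverse. *)
Definition pseudoinverse (R : realType) m n (A : 'M[R]_(m, n)) :
  'M[R]_(n, m) := xget 0 [set X | is_pseudoinverse A X].

(* Real eigenvalues in nondecreasing order, each repeated according to its
   algebraic multiplicity ([rootsR] lists the distinct real roots in increasing
   order).  It is only used on symmetric matrices, whose eigenvalues are all
   real. *)
Definition spectrum (R : realType) n (M : 'M[R]_n) : seq R :=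
  flatten [seq nseq (mup a (char_poly M)) a | a <- rootsR (char_poly M)].

Definition lambda_max (R : realType) n (M : 'M[R]_n) : R :=
  last 0 (spectrum M).

(* The default value 0 is returned when there is no nonzero eigenvalue. *)
Definition lambda_min_pos (R : realType) n (M : 'M[R]_n) : R :=
  head 0 [seq a <- spectrum M | a != 0].

(* T is given by its enumeration tau_1, ..., tau_d.  Every count is at most d,
   so the unit d of the iterated minimum is neutral. *)
Definition row_covering (R : realType) m n (A : 'M[R]_(m, n)) d
    (tau : 'I_d -> {set 'I_m}) (alpha beta : R) (rmin rmax : nat) : Prop :=
  [/\ forall i, exists l, i \in tau l,
      forall l, alpha <= lambda_min_pos (restrict (tau l) A *m
                                         (restrict (tau l) A)^T),
      forall l, lambda_max (restrict (tau l) A *m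
                            (restrict (tau l) A)^T) <= beta,
      rmin = \big[minn/d]_(i < m) #|[set l | i \in tau l]%SET| &
      rmax = (\max_(i < m) #|[set l | i \in tau l]%SET|)%N].

Record graph (V : finType) := Graph {
  edges : {set {set V}};
  edge_card : forall e, e \in edges -> #|e| = 2 }.

Definition adjacent (V : finType) (G : graph V) : rel V :=
  fun x y => [set x; y]%SET \in edges G.

Definition connected_graph (V : finType) (G : graph V) : Prop :=
  forall x y : V, connect (adjacent G) x y.

(* Rows and columns follow the canonical enumerations of the edges and of the
   nodes; the orientation of each edge is arbitrary. *)
Definition incidence_matrix (R : realType) (V : finType) (G : graph V)
    (Q : 'M[R]_(#|edges G|, #|V|)) : Prop :=
  forall i : 'I_#|edges G|, exists x y : V,
    [/\ x != y, enum_val i = [set x; y]%SET,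
        Q i (enum_rank x) = 1, Q i (enum_rank y) = -1 &
        forall z, z != x -> z != y -> Q i (enum_rank z) = 0].

(* Second smallest eigenvalue (with multiplicity) of the Laplacian Q^T Q. *)
Definition algebraic_connectivity (R : realType) m n (Q : 'M[R]_(m, n)) : R :=
  nth 0 (spectrum (Q^T *m Q)) 1.

(* [s j] is the index of the block used in the (j+1)-st iteration. *)
Fixpoint block_gossip (R : realType) m n (Q : 'M[R]_(m, n)) (mis : 'cV[R]_m)
    d (tau : 'I_d -> {set 'I_m}) (c : 'cV[R]_n) (s : nat -> 'I_d) (k : nat) :
    'cV[R]_n :=
  if k is k'.+1 then
    let c' := block_gossip Q mis tau c s k' in
    let t := tau (s k') in
    c' + pseudoinverse (restrict t Q) *m
           (restrict t mis - restrict t Q *m c')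
  else c.

(* The X j are mutually independent random indices, each uniform on 'I_d (with
   its discrete sigma-algebra). *)
Definition iid_uniform (R : realType) (disp : measure_display)
    (Omega : measurableType disp) (P : probability Omega R) d
    (X : nat -> Omega -> 'I_d) : Prop :=
  [/\ forall j (B : set 'I_d), measurable (X j @^-1` B),
      forall j (l : 'I_d), P (X j @^-1` [set l]) = (d%:R^-1)%:E &
      forall (J : seq nat) (B : nat -> set 'I_d), uniq J ->
        P (\bigcap_(j in [set` J]) (X j @^-1` B j)) =
        (\prod_(j <- J) P (X j @^-1` B j))%E].

(* Main.v *)
Require Import Defs.
From HB Require Import structures.
From mathcomp Require Import all_boot all_order all_algebra.
From mathcomp Require Import spectral sesquilinear.
From mathcomp Require Import polyrcf complex.
From mathcomp Require Import all_classical all_reals all_analysis.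
From mathcomp Require Import measurable_realfun.
From mathcomp Require Import ring lra zify.
Import Order.TTheory GRing.Theory Num.Theory.
Local Open Scope ring_scope.

(** Write e for the error c_k - c*, A for the block Q_tau and X for its
    pseudoinverse.  Since Q kills constant vectors, Q c* = 0, and one iteration
    sends e to (e - X A e) + X m_tau.  The matrix X A is the orthogonal
    projection onto the row space of A, and X m_tau lies in that space, so by
    Pythagoras the new squared error is
    |e|^2 - |X A e|^2 + |X m_tau|^2.  The spectral bounds of the covering give
    |A e|^2 = |A (X A e)|^2 <= beta |X A e|^2 and alpha |X m_tau|^2 <= |m_tau|^2
    ([projection_step_le]).

    Averaging over the blocks, each row is counted between r and R times, so
    the mean of |Q_tau e|^2 is at least (r/d) |Q e|^2 and that of |m_tau|^2 is at
    most (R/d) |m|^2 ([covering_sum_ge], [covering_sum_le]).  The error stays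
    orthogonal to the all-ones vector, which spans the kernel of the Laplacian of
    a connected graph, hence |Q e|^2 >= a |e|^2 with a the algebraic
    connectivity ([algebraic_connectivity_le]).  Together this is the one-step
    estimate E |e'|^2 <= rho |e|^2 + R |m|^2 / (alpha d) ([gossip_average]), and
    the horizon is the fixed point of the map t -> rho t + R |m|^2 / (alpha d).
    The rate rho is nonnegative because |A e|^2 <= beta |e|^2 can be averaged in
    the same way at a single nonzero e orthogonal to the all-ones vector.

    The spectral bounds rest on the spectral theorem for real symmetric
    matrices, obtained from the unitary diagonalization of Hermitian
    matrices ([symmetric_spectral]).  The expectation is turned into a finite
    average: the k-th iterate takes the d^k values listed by [reach], each with
    weight d^-k ([expectation_run]). *)

Set Implicit Arguments.
Unset Strict Implicit.
Local Notation restrict := Defs.restrict.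
Local Notation adjacent := Defs.adjacent.

(** * The Euclidean inner product *)

Definition dot (R : realType) n (u v : 'cV[R]_n) : R := (u^T *m v) 0 0.

Section Dot.
Variable R : realType.
Implicit Types m n : nat.

Lemma dotE n (u v : 'cV[R]_n) : dot u v = \sum_i u i 0 * v i 0.
Proof. by rewrite /dot mxE; apply: eq_bigr => i _; rewrite mxE. Qed.

Lemma enorm_sqr n (u : 'cV[R]_n) : enorm u ^+ 2 = dot u u.
Proof.
rewrite /enorm sqr_sqrtr ?sumr_ge0// => [|i _]; last exact: sqr_ge0.
by rewrite dotE; apply: eq_bigr.
Qed.

Lemma dotC n (u v : 'cV[R]_n) : dot u v = dot v u.
Proof. by rewrite !dotE; apply: eq_bigr => i _; rewrite mulrC. Qed.

Lemma dotDr n (u v w : 'cV[R]_n) : dot u (v + w) = dot u v + dot u w.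
Proof. by rewrite /dot mulmxDr mxE. Qed.

Lemma dotDl n (u v w : 'cV[R]_n) : dot (v + w) u = dot v u + dot w u.
Proof. by rewrite dotC dotDr !(dotC u). Qed.

Lemma dotZr n a (u v : 'cV[R]_n) : dot u (a *: v) = a * dot u v.
Proof. by rewrite /dot -scalemxAr mxE. Qed.

Lemma dotZl n a (u v : 'cV[R]_n) : dot (a *: u) v = a * dot u v.
Proof. by rewrite dotC dotZr dotC. Qed.

Lemma dotNr n (u v : 'cV[R]_n) : dot u (- v) = - dot u v.
Proof. by rewrite /dot mulmxN mxE. Qed.

Lemma dotNl n (u v : 'cV[R]_n) : dot (- u) v = - dot u v.
Proof. by rewrite dotC dotNr dotC. Qed.

Lemma dot_trmx m n (A : 'M[R]_(m, n)) u v :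
  dot u (A *m v) = dot (A^T *m u) v.
Proof. by rewrite /dot trmx_mul trmxK mulmxA. Qed.

Lemma dot_ge0 n (u : 'cV[R]_n) : 0 <= dot u u.
Proof. by rewrite dotE sumr_ge0// => i _; rewrite -expr2 sqr_ge0. Qed.

Lemma dot_eq0 n (u : 'cV[R]_n) : (dot u u == 0) = (u == 0).
Proof.
apply/eqP/eqP => [|->]; last by rewrite dotE big1// => i _; rewrite mxE mul0r.
rewrite dotE => /eqP; rewrite psumr_eq0 => [|i _]; last first.
  by rewrite -expr2 sqr_ge0.
move=> /allP u0; apply/colP => i; rewrite mxE.
by have /eqP := u0 i (mem_index_enum _); rewrite -expr2 => /eqP; rewrite sqrf_eq0 => /eqP.
Qed.

End Dot.

(** * The spectral theorem for real symmetric matrices *)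

Section Spectral.
Variable R : realType.
Implicit Types m n : nat.

Lemma spectrum_sorted n (M : 'M[R]_n) : sorted <=%R (spectrum M).
Proof.
rewrite sorted_pairwise; last exact: le_trans.
have : pairwise <%R (rootsR (char_poly M)).
  by rewrite -sorted_pairwise; [exact: sorted_roots | exact: lt_trans].
rewrite /spectrum; elim: (rootsR _) => //= a s ih /andP[/allP as_ /ih ps].
rewrite pairwise_cat ps andbT; apply/andP; split.
  apply/allrelP => x y /nseqP[-> _] /flattenP[_ /mapP[b bs ->]].
  by move=> /nseqP[-> _]; exact/ltW/as_.
elim: (mup _ _) => //= k ->.
by rewrite andbT; apply/allP => x /nseqP[->].
Qed.

(** A fully factored characteristic polynomial determines the spectrum: both
    lists have the same number of occurrences of each value, namely its
    multiplicity as a root. *)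
Lemma spectrum_perm n (M : 'M[R]_n) (D : 'rV[R]_n) :
  char_poly M = \prod_i ('X - (D 0 i)%:P) ->
  perm_eq (spectrum M) [seq D 0 i | i <- enum 'I_n].
Proof.
move=> pM; apply/allP => x _; apply/eqP.
have -> : count_mem x [seq D 0 i | i <- enum 'I_n] = mup x (char_poly M).
  by rewrite pM -mu_prod_XsubC big_map big_enum.
rewrite /spectrum count_flatten -map_comp sumnE big_map.
under eq_bigr => a _ do rewrite /= count_nseq /=.
have p0 : char_poly M != 0 by rewrite monic_neq0// char_poly_monic.
have [rx|nrx] := boolP (root (char_poly M) x); last first.
  rewrite mupNroot// big1_seq// => a /andP[_ ar]; case: eqP => [ax|]; last first.
    by rewrite mul0n.
  by move: nrx ar; rewrite -roots_on_rootsR// ax => /negbTE ->.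
rewrite (big_rem x)/=; last by rewrite -roots_on_rootsR// rx.
rewrite eqxx mul1n big1_seq ?addn0// => a /andP[_].
rewrite mem_rem_uniq ?inE ?uniq_roots// => /andP[/negbTE -> _].
by rewrite mul0n.
Qed.

Local Notation C := R[i].
Local Notation "x %:C" := (real_complex R x).
Local Notation toC := (map_mx (real_complex R)).

Lemma real_mx_conj m n (A : 'M[R]_(m, n)) :
  map_mx Num.conj (toC A) = toC A.
Proof.
by rewrite -map_mx_comp; apply: eq_map_mx => x /=; exact: conjc_real.
Qed.

Lemma Re_sqr_norm (z : C) : (complex.Re (`|z| ^+ 2))%:C = `|z| ^+ 2.
Proof. by apply: RRe_real; rewrite rpredX// normr_real. Qed.

(** A quadratic form becomes a weighted sum in the coordinates U x.  The weights
    |(U x)_i|^2 depend on U only, so that matrices diagonalized by the same U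
    share them. *)
Lemma unitary_form n (U : 'M[C]_n) (N : 'M[R]_n) (E : 'rV[R]_n) (x : 'cV[R]_n) :
  toC N = map_mx Num.conj U^T *m diag_mx (toC E) *m U ->
  dot x (N *m x) =
  \sum_i E 0 i * complex.Re (`|(U *m toC x) i 0| ^+ 2).
Proof.
move=> NE; apply: (@complexI R).
have -> : (dot x (N *m x))%:C = ((toC x)^T *m toC N *m toC x) 0 0.
  by rewrite /dot map_trmx -!map_mxM /= mulmxA [RHS]mxE.
rewrite NE !mulmxA -mulmxA rmorph_sum mxE; apply: eq_bigr => i _.
have -> : ((toC x)^T *m map_mx Num.conj U^T *m diag_mx (toC E)) 0 i
    = (E 0 i)%:C * Num.conj ((U *m toC x) i 0).
  rewrite mul_mx_diag [LHS]mxE mulrC; congr (_ * _); first by rewrite mxE.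
  have -> : (toC x)^T *m map_mx Num.conj U^T = map_mx Num.conj (U *m toC x)^T.
    by rewrite trmx_mul map_mxM /= map_trmx real_mx_conj.
  by rewrite !mxE.
rewrite -mulrA -normCKC rmorphM; congr (_ * _).
exact/esym/Re_sqr_norm.
Qed.

Local Notation toP := (map_mx polyC).

Lemma char_poly_conj (K : fieldType) n (P A : 'M[K]_n) : P \in unitmx ->
  char_poly (invmx P *m A *m P) = char_poly A.
Proof.
move=> Pu.
have PP : toP (invmx P) *m toP P = 1%:M by rewrite -map_mxM mulVmx// map_mx1.
have -> : char_poly (invmx P *m A *m P)
    = \det (toP (invmx P) *m char_poly_mx A *m toP P).
  congr (\det _); rewrite /char_poly_mx mulmxBr mulmxBl !map_mxM/=.
  by rewrite scalar_mxC -!mulmxA PP mulmx1.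
by rewrite !det_mulmx mulrAC -det_mulmx [toP _ *m _]PP det1 mul1r.
Qed.

(** The diagonal matrix factors through the coordinates in its support, and the
    nonzero rows have a right inverse made of the inverse entries. *)
Lemma mxrank_diag (K : fieldType) n (d : 'rV[K]_n) :
  \rank (diag_mx d) = #|[pred i | d 0 i != 0]|.
Proof.
set S := [pred i | _]; pose f : 'I_#|S| -> 'I_n := enum_val.
have fS k : d 0 (f k) != 0 by have := enum_valP k.
apply/eqP; rewrite eqn_leq; apply/andP; split.
  have -> : diag_mx d = colsub f (1%:M) *m rowsub f (diag_mx d).
    apply/matrixP => i j; rewrite !mxE.
    have [di|di] := eqVneq (d 0 i) 0.
      rewrite di mul0rn big1// => k _; rewrite !mxE.
      case: eqP => [ik|]; last by rewrite mul0r.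
      by have := fS k; rewrite -ik di eqxx.
    have [k0 ->] : exists k, i = f k.
      have iS : i \in S by [].
      by exists (enum_rank_in iS i); rewrite /f enum_rankK_in.
    rewrite (bigD1 k0)//= !mxE eqxx mul1r big1 ?addr0// => k kn.
    by rewrite !mxE (inj_eq enum_val_inj) eq_sym (negbTE kn) mul0r.
  exact: mulmx_max_rank.
have : rowsub f (diag_mx d) *m colsub f (diag_mx (\row_i (d 0 i)^-1)) = 1%:M.
  apply/matrixP => k l; rewrite !mxE (bigD1 (f k))//= !mxE eqxx mulr1n.
  rewrite big1 ?addr0 => [|i ik]; last by rewrite !mxE eq_sym (negbTE ik) mul0r.
  rewrite (inj_eq enum_val_inj).
  by case: eqP => [_|]; rewrite ?mulr0// mulr1n divff.
move=> /(congr1 mxrank); rewrite mxrank1 => <-.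
by apply: leq_trans (mxrankM_maxl _ _) _; exact: mxrankS (rowsub_sub _ _).
Qed.

(** The spectral theorem in the form needed below.  The matrix is diagonalized
    over R[i], where it is Hermitian, so that D is real; the eigenvectors may be
    complex, and only the squared moduli w of the coordinates of x in that
    eigenbasis are kept.  The same w serves the three identities, which reduces
    inequalities between these forms to inequalities on eigenvalues. *)
Lemma symmetric_spectral n (M : 'M[R]_n) : M^T = M ->
  exists D : 'rV[R]_n,
  [/\ perm_eq (spectrum M) [seq D 0 i | i <- enum 'I_n],
      \rank M = #|[pred i | D 0 i != 0]| &
      forall x : 'cV[R]_n, exists w : 'I_n -> R,
      [/\ forall i, 0 <= w i,
          dot x x = \sum_i w i,
          dot x (M *m x) = \sum_i D 0 i * w i &
          dot (M *m x) (M *m x) = \sum_i D 0 i ^+ 2 * w i]].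
Proof.
move=> sM; pose A : 'M[C]_n := toC M.
have Areal : A \is a mxOver Num.real.
  by apply/mxOverP => i j; rewrite mxE; apply/complex_realP; exists (M i j).
have Ah : A \is hermsymmx.
  apply: realsym_hermsym => //; apply/is_hermitianmxP.
  by rewrite expr0 scale1r map_mx_id// map_trmx sM.
have /orthomx_spectralP := hermitian_normalmx Ah.
have /mxOverP Dr := hermitian_spectral_diag_real Ah.
set U := spectralmx A; set S := spectral_diag A in Dr *.
have Uu : U \is unitarymx := spectral_unitarymx A.
have Ui : U \in unitmx := spectral_unit A.
pose D : 'rV[R]_n := \row_i complex.Re (S 0 i).
have SD : S = toC D.
  by apply/rowP => i; rewrite !mxE; rewrite -[LHS]RRe_real.
rewrite SD => AE; have AE' := AE; rewrite invmx_unitary// in AE'.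
exists D; split.
- apply: spectrum_perm; apply: (map_poly_inj (real_complex R)).
  rewrite map_char_poly -/A (rmorph_prod (map_poly (real_complex R))).
  have -> : char_poly A = char_poly (diag_mx (toC D)).
    by rewrite AE char_poly_conj.
  rewrite char_poly_trig ?diag_mx_is_trig//; apply: eq_bigr => i _.
  by rewrite !mxE eqxx mulr1n rmorphB /= map_polyX map_polyC.
- rewrite -(mxrank_map (real_complex R)) -/A AE mxrankMfree ?row_free_unit//.
  rewrite -mxrank_tr trmx_mul mxrankMfree ?row_free_unit ?unitmx_tr ?unitmx_inv//.
  rewrite mxrank_tr mxrank_diag; apply: eq_card => i.
  by rewrite !inE !mxE fmorph_eq0.
move=> x; exists (fun i => complex.Re (`|(U *m toC x) i 0| ^+ 2)); split.
- move=> i; rewrite -lecR Re_sqr_norm.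
  by rewrite exprn_ge0.
- rewrite -[X in dot _ X]mul1mx.
  rewrite (@unitary_form _ U _ (const_mx 1)).
    by apply: eq_bigr => i _; rewrite mxE mul1r.
  rewrite map_mx1 map_const_mx rmorph1 diag_const_mx mulmx1.
  by rewrite -invmx_unitary// mulVmx.
- exact: unitary_form.
- rewrite dot_trmx dotC sM mulmxA (@unitary_form _ U _ (\row_i D 0 i ^+ 2)).
    by apply: eq_bigr => i _; rewrite mxE.
  rewrite map_mxM -/A {1}AE' AE -!mulmxA (mulmxA U) mulmxV// mul1mx.
  rewrite !mulmxA -(mulmxA _ (diag_mx _) (diag_mx _)) mulmx_diag.
  by congr (_ *m diag_mx _ *m _); apply/rowP => i; rewrite !mxE -rmorphM expr2.
Qed.

End Spectral.

(** * Spectral bounds on quadratic forms and Gram matrices *)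

Section Rayleigh.
Variable R : realType.
Implicit Types m n : nat.

Lemma rayleigh_le n (M : 'M[R]_n) b x : M^T = M ->
  {in spectrum M, forall a, a <= b} -> dot x (M *m x) <= b * dot x x.
Proof.
move=> /symmetric_spectral[D [pD _ /(_ x)[w [w0 -> -> _]]]] leb.
rewrite mulr_sumr ler_sum// => i _; rewrite ler_wpM2r// leb//.
by rewrite (perm_mem pD) map_f// mem_enum.
Qed.

(** On eigenvalues this is a l <= l^2, which holds for l = 0 as well as for
    l >= a: it remains valid on singular matrices. *)
Lemma rayleigh_square_ge n (M : 'M[R]_n) a x : M^T = M -> 0 <= a ->
  {in spectrum M, forall l, l != 0 -> a <= l} ->
  a * dot x (M *m x) <= dot (M *m x) (M *m x).
Proof.
move=> /symmetric_spectral[D [pD _ /(_ x)[w [w0 _ -> ->]]]] a0 lea.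
rewrite mulr_sumr ler_sum// => i _; rewrite mulrA expr2 ler_wpM2r//.
have [->|Di0] := eqVneq (D 0 i) 0; first by rewrite !mulr0.
have aD : a <= D 0 i by rewrite lea// (perm_mem pD) map_f// mem_enum.
by rewrite ler_wpM2r// (le_trans a0).
Qed.

Lemma le_lambda_max n (M : 'M[R]_n) : {in spectrum M, forall a, a <= lambda_max M}.
Proof.
rewrite /lambda_max => a; have := spectrum_sorted M.
case: (spectrum M) => // b s /=; elim: s a b => [a b _|c s ih a b /andP[bc sc]].
  by rewrite inE => /eqP ->.
rewrite inE => /orP[/eqP ->|]; last exact: ih.
by apply: le_trans bc _; apply: ih => //; rewrite mem_head.
Qed.

Lemma ge_lambda_min_pos n (M : 'M[R]_n) :
  {in spectrum M, forall a, a != 0 -> lambda_min_pos M <= a}.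
Proof.
move=> a aM a0; rewrite /lambda_min_pos.
have := sorted_filter le_trans (fun a => a != 0) (spectrum_sorted M).
have : a \in [seq l <- spectrum M | l != 0] by rewrite mem_filter a0.
case: [seq _ <- _ | _] => // b s; rewrite inE => /orP[/eqP ->//|as_] /=.
by rewrite le_path_sortedE => /andP[/allP /(_ _ as_)].
Qed.

Lemma tr_gram m n (A : 'M[R]_(m, n)) : (A *m A^T)^T = A *m A^T.
Proof. by rewrite trmx_mul trmxK. Qed.

(** The hypothesis is on A A^T, the conclusion on A^T A.  With p = |A v|^2,
    expanding 0 <= |b v - A^T A v|^2 and using |A^T (A v)|^2 <= b p gives
    0 <= b^2 |v|^2 - b p. *)
Lemma norm_mul_le m n (A : 'M[R]_(m, n)) b v : 0 < b ->
  {in spectrum (A *m A^T), forall a, a <= b} ->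
  dot (A *m v) (A *m v) <= b * dot v v.
Proof.
move=> b0 leb; have := rayleigh_le (A *m v) (tr_gram A) leb.
rewrite -[A *m A^T *m _]mulmxA dot_trmx => h.
have := dot_ge0 (b *: v - A^T *m (A *m v)).
rewrite !(dotDl, dotDr, dotNl, dotNr, dotZl, dotZr).
rewrite [dot (_ *m _) v]dotC [dot v (_ *m _)]dot_trmx trmxK.
move: h; set p := dot (A *m v) _; set q := dot v v; set s := dot (_ *m _) _.
move=> h g; rewrite -(ler_pM2l b0); lra.
Qed.

Lemma norm_mul_ge m n (A : 'M[R]_(m, n)) a u : 0 <= a ->
  {in spectrum (A *m A^T), forall l, l != 0 -> a <= l} ->
  a * dot (A^T *m u) (A^T *m u) <= dot (A *m (A^T *m u)) (A *m (A^T *m u)).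
Proof.
move=> a0 lea; have := rayleigh_square_ge u (tr_gram A) a0 lea.
by rewrite -mulmxA dot_trmx.
Qed.

(** The lower bound on the range of A A^T, as opposed to that of A^T in
    [norm_mul_ge].  With e = A A^T u, expand 0 <= |A^T e - a A^T u|^2; the cross
    term is |e|^2, and a |A^T u|^2 <= |e|^2. *)
Lemma norm_trmul_ge m n (A : 'M[R]_(m, n)) a u : 0 <= a ->
  {in spectrum (A *m A^T), forall l, l != 0 -> a <= l} ->
  forall e, e = A *m A^T *m u -> a * dot e e <= dot (A^T *m e) (A^T *m e).
Proof.
move=> a0 lea e eE; have := norm_mul_ge u a0 lea.
have := dot_ge0 (A^T *m e - a *: (A^T *m u)).
rewrite !(dotDl, dotDr, dotNl, dotNr, dotZl, dotZr).
rewrite [dot (A^T *m u) (A^T *m e)]dotC.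
rewrite -[dot (A^T *m e) (A^T *m u)]dot_trmx !mulmxA -eE.
set p := dot e e; set q := dot (A^T *m u) _; set s := dot (A^T *m e) _ => h1 h2.
have := ler_wpM2l a0 h2; lra.
Qed.

Lemma spectrum_gram_ge0 m n (A : 'M[R]_(m, n)) :
  {in spectrum (A *m A^T), forall a, 0 <= a}.
Proof.
move=> a aM.
have : eigenvalue (A *m A^T) a.
  rewrite eigenvalue_root_char; move: aM => /flattenP[_ /mapP[b br ->]].
  move=> /nseqP[-> _]; move: br; rewrite -roots_on_rootsR//=.
  by rewrite monic_neq0// char_poly_monic.
move=> /eigenvalueP[v vM v0]; have := dot_ge0 (A^T *m v^T).
rewrite -dot_trmx mulmxA -[_ *m v^T]trmxK trmx_mul trmxK tr_gram vM.
rewrite linearZ /= dotZr pmulr_lge0// lt_neqAle dot_ge0 andbT eq_sym dot_eq0.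
by rewrite -(inj_eq trmx_inj) trmxK trmx0.
Qed.

End Rayleigh.

(** * Pseudoinverses and projection steps *)

Section Pseudoinverse.
Variable R : realType.
Implicit Types m n : nat.

Lemma gram_unitmx m n (A : 'M[R]_(m, n)) : row_free A -> A *m A^T \in unitmx.
Proof.
move=> fA; rewrite -row_free_unit -kermx_eq0; apply/rowV0P => u /sub_kermxP uA.
apply/eqP; rewrite -(mulmx_free_eq0 _ fA) -(inj_eq trmx_inj) trmx0 -dot_eq0.
by rewrite /dot trmxK trmx_mul -mulmxA [A *m _]mulmxA mulmxA uA mul0mx mxE.
Qed.

(** A full-rank factorization A = B C gives the pseudoinverse
    C^T (C C^T)^-1 (B^T B)^-1 B^T, both Gram matrices being invertible over the
    reals. *)
Lemma pseudoinverse_exists m n (A : 'M[R]_(m, n)) :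
  exists X, is_pseudoinverse A X.
Proof.
have [r [B [C [AE fB fC]]]] : exists r (B : 'M[R]_(m, r)) (C : 'M[R]_(r, n)),
    [/\ A = B *m C, row_full B & row_free C].
  exists (\rank A), (col_base A), (row_base A).
  by rewrite mulmx_base row_base_free col_base_full.
have Cu : C *m C^T \in unitmx by rewrite gram_unitmx.
have Bu : B^T *m B \in unitmx.
  by rewrite -{2}[B]trmxK gram_unitmx// /row_free mxrank_tr.
exists (C^T *m invmx (C *m C^T) *m (invmx (B^T *m B) *m B^T)).
set X := _ *m (_ *m _).
have AX : A *m X = B *m invmx (B^T *m B) *m B^T.
  by rewrite AE /X -!mulmxA (mulmxA C) (mulmxA (C *m _)) mulmxV// mul1mx.
have XA : X *m A = C^T *m invmx (C *m C^T) *m C.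
  by rewrite AE /X -!mulmxA (mulmxA B^T) (mulmxA (invmx (B^T *m B))) mulVmx// mul1mx.
split.
- by rewrite AX AE -!mulmxA (mulmxA B^T) (mulmxA (invmx (B^T *m B))) mulVmx// mul1mx.
- rewrite XA /X -!mulmxA (mulmxA C) (mulmxA (invmx (C *m C^T)) (C *m C^T)).
  by rewrite mulVmx// mul1mx.
- by rewrite AX !trmx_mul trmxK trmx_inv trmx_mul trmxK mulmxA.
- by rewrite XA !trmx_mul trmxK trmx_inv trmx_mul trmxK mulmxA.
Qed.

Lemma pseudoinverseP m n (A : 'M[R]_(m, n)) :
  is_pseudoinverse A (pseudoinverse A).
Proof. by rewrite /pseudoinverse; apply: xgetPex; exact: pseudoinverse_exists. Qed.

(** X = X A X = (X A)^T X, so that the values of the pseudoinverse X lie in the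
    row space of A: the lower spectral bound of A applies to them, and they are
    orthogonal to the kernel of A. *)
Lemma pseudoinverse_row_space m n (A : 'M[R]_(m, n)) (w : 'cV[R]_m) :
  pseudoinverse A *m w = A^T *m ((pseudoinverse A)^T *m (pseudoinverse A *m w)).
Proof.
have [_ XAX _ sXA] := pseudoinverseP A.
by rewrite -{1}XAX -sXA trmx_mul !mulmxA.
Qed.

Lemma dot_ker_pseudoinverse m n (A : 'M[R]_(m, n)) z w :
  A *m z = 0 -> dot z (pseudoinverse A *m w) = 0.
Proof.
by move=> Az; rewrite pseudoinverse_row_space dot_trmx trmxK Az /dot trmx0 mul0mx mxE.
Qed.

(** X w is in the row space, hence a |X w|^2 <= |A X w|^2, and A X is an
    orthogonal projection, which does not increase |w|. *)
Lemma pseudoinverse_norm_le m n (A : 'M[R]_(m, n)) a w : 0 < a ->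
  {in spectrum (A *m A^T), forall l, l != 0 -> a <= l} ->
  a * dot (pseudoinverse A *m w) (pseudoinverse A *m w) <= dot w w.
Proof.
move=> a0 lea; rewrite pseudoinverse_row_space.
apply: le_trans (norm_mul_ge _ (ltW a0) lea) _.
rewrite -pseudoinverse_row_space mulmxA.
have [AXA _ sAX _] := pseudoinverseP A.
have := dot_ge0 (w - A *m pseudoinverse A *m w).
rewrite !(dotDl, dotDr, dotNl, dotNr) [dot (_ *m _) w]dotC.
have -> : dot w (A *m pseudoinverse A *m w)
   = dot (A *m pseudoinverse A *m w) (A *m pseudoinverse A *m w).
  by rewrite [RHS]dot_trmx sAX dotC !mulmxA AXA.
lra.
Qed.

(** Pythagoras: e - X A e is orthogonal to the row space of A, which contains
    X A e and X w.  The correction thus removes |X A e|^2 and adds |X w|^2. *)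
Lemma projection_step_le m n (A : 'M[R]_(m, n)) a b (e : 'cV[R]_n) w :
  0 < a -> 0 < b ->
  {in spectrum (A *m A^T), forall l, l != 0 -> a <= l} ->
  {in spectrum (A *m A^T), forall l, l <= b} ->
  let e' := e + pseudoinverse A *m (w - A *m e) in
  dot e' e' <= dot e e - b^-1 * dot (A *m e) (A *m e) + a^-1 * dot w w.
Proof.
move=> a0 b0 lea leb; set X := pseudoinverse A => /=.
have [AXA XAX _ sXA] := pseudoinverseP A.
have Xw := pseudoinverse_norm_le w a0 lea.
have Ae : b^-1 * dot (A *m e) (A *m e) <= dot (X *m A *m e) (X *m A *m e).
  rewrite ler_pdivrMl//; have := norm_mul_le (X *m A *m e) b0 leb.
  by rewrite !mulmxA AXA.
have Xw' : dot (X *m w) (X *m w) <= a^-1 * dot w w by rewrite ler_pdivlMl.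
have eXA u : dot e (X *m A *m u) = dot (X *m A *m e) u.
  by rewrite dot_trmx sXA.
have e1 : dot e (X *m A *m e) = dot (X *m A *m e) (X *m A *m e).
  by rewrite -eXA !mulmxA XAX.
have e2 : dot (X *m A *m e) (X *m w) = dot e (X *m w).
  by rewrite -eXA !mulmxA XAX.
rewrite mulmxBr mulmxA !(dotDl, dotDr, dotNl, dotNr).
rewrite [dot (X *m A *m e) e]dotC e1 [dot (X *m w) e]dotC.
rewrite [dot (X *m w) (X *m A *m e)]dotC e2.
lra.
Qed.

End Pseudoinverse.

(** * The Laplacian of a connected graph *)

Section Laplacian.
Variables (R : realType) (V : finType) (G : graph V).
Variable Q : 'M[R]_(#|edges G|, #|V|).
Hypothesis hQ : incidence_matrix Q.
Local Notation n := #|V|.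

Lemma incidence_mul i : exists x y, enum_val i = [set x; y]%SET /\
  forall v : 'cV[R]_n, (Q *m v) i 0 = v (enum_rank x) 0 - v (enum_rank y) 0.
Proof.
have [x [y [xy iE Qx Qy Q0]]] := hQ i; exists x, y; split=> // v.
rewrite mxE (bigD1 (enum_rank x))//= (bigD1 (enum_rank y))/=; last first.
  by rewrite (inj_eq enum_rank_inj) eq_sym.
rewrite Qx Qy mul1r mulN1r big1 ?addr0// => j /andP[jx jy].
rewrite -[j]enum_valK Q0 ?mul0r//.
  by apply: contraNneq jx => <-; rewrite enum_valK.
by apply: contraNneq jy => <-; rewrite enum_valK.
Qed.

Lemma incidence_const a : Q *m (const_mx a : 'cV[R]_n) = 0.
Proof.
apply/colP => i; have [x [y [_ ->]]] := incidence_mul i.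
by rewrite !mxE subrr.
Qed.

Hypothesis hG : connected_graph G.
Hypothesis hV : (1 < n)%N.

(** Equality of the values along each edge propagates along paths. *)
Lemma incidence_ker v : Q *m v = 0 -> exists a, v = const_mx a :> 'cV[R]_n.
Proof.
move=> Qv; pose f x := v (enum_rank x) 0.
have adjf (x y : V) : adjacent G x y -> f x = f y.
  rewrite /adjacent => xy.
  have [x' [y' [iE vE]]] := incidence_mul (enum_rank_in xy [set x; y]%SET).
  have : f x' = f y'.
    by apply/eqP; rewrite -subr_eq0 /f -vE Qv mxE.
  rewrite enum_rankK_in// in iE.
  have : x \in [set x'; y']%SET by rewrite -iE !inE eqxx.
  have : y \in [set x'; y']%SET by rewrite -iE !inE eqxx orbT.
  by rewrite !inE => /orP[] /eqP -> /orP[] /eqP ->.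
pose x0 : V := enum_val (Ordinal (ltnW hV)).
exists (f x0); apply/colP => j; rewrite mxE -[j]enum_valK -[LHS]/(f _).
have /connectP[p pp ->] := hG x0 (enum_val j).
elim: p x0 pp => //= y p ih x0 /andP[/adjf xy /ih ->].
by rewrite xy.
Qed.

Local Notation L := (Q^T *m Q).
Local Notation ones := (const_mx 1 : 'cV[R]_n).

Lemma rank_ones : \rank ones = 1%N.
Proof.
rewrite -mxrank_tr rank_rV; case: eqP => // /rowP /(_ (Ordinal (ltnW hV))).
by rewrite !mxE => /eqP; rewrite oner_eq0.
Qed.

Lemma tr_laplacian : L^T = L.
Proof. by rewrite trmx_mul trmxK. Qed.

(** The Laplacian and Q have the same kernel, because u L = 0 forces
    |Q u|^2 = 0; that kernel is the line of constant vectors. *)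
Lemma rank_laplacian : \rank L = n.-1.
Proof.
have : (kermx L == ones^T)%MS.
  apply/andP; split; last first.
    by apply/sub_kermxP; rewrite mulmxA -trmx_mul incidence_const trmx0 mul0mx.
  apply/rV_subP => u /sub_kermxP uL.
  have Qu : Q *m u^T = 0.
    apply/eqP; rewrite -dot_eq0 -(trmxK Q) -dot_trmx trmxK mulmxA.
    by rewrite -[L]tr_laplacian -trmx_mul uL trmx0 /dot mulmx0 mxE.
  have [a ua] := incidence_ker Qu; rewrite -[u]trmxK ua.
  apply/submxP; exists a%:M; rewrite mul_scalar_mx.
  by apply/rowP => i; rewrite !mxE mulr1.
move=> /eqmx_rank; rewrite mxrank_ker mxrank_tr rank_ones => e.
by have := rank_leq_row L; move: hV e; lia.
Qed.

(** The eigenvalues are nonnegative and, by the rank, exactly one vanishes.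
    Being sorted, the list starts with that zero, and its second entry is the
    least nonzero eigenvalue. *)
Lemma laplacian_gap : 0 < algebraic_connectivity Q /\
  {in spectrum L, forall l, l != 0 -> algebraic_connectivity Q <= l}.
Proof.
have [D [pD rk _]] := symmetric_spectral tr_laplacian.
have sz : size (spectrum L) = n by rewrite (perm_size pD) size_map size_enum_ord.
have c0 : count_mem 0 (spectrum L) = 1%N.
  rewrite (permP pD) count_map; have := cardC [pred i | D 0 i != 0].
  rewrite -rk rank_laplacian card_ord => e.
  have -> : count (preim (fun i => D 0 i) (pred1 0)) (enum 'I_n) =
            #|[predC [pred i | D 0 i != 0]]|.
    rewrite -[RHS]sum1_card -sum1_count big_enum_cond; apply: eq_bigl => i.
    by rewrite !inE negbK.
  by apply: (@addnI n.-1); rewrite addn1 prednK ?(ltnW hV).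
have ge0 : {in spectrum L, forall a, 0 <= a}.
  by have := @spectrum_gram_ge0 _ _ _ Q^T; rewrite trmxK.
have := spectrum_sorted L; move: sz c0 ge0; rewrite /algebraic_connectivity.
case: (spectrum L) => [|s0 [|s1 t]]; try by move: hV => /[swap] <-.
move=> _ /= c0 ge0 /andP[s01 st].
have s1t l : l \in t -> s1 <= l.
  by move: st; rewrite le_path_sortedE => /andP[/allP h _]; apply: h.
have s0_ge0 : 0 <= s0 by rewrite ge0// mem_head.
have s1_gt0 : 0 < s1.
  rewrite lt_neqAle (le_trans s0_ge0 s01) andbT; apply/eqP => s1E.
  move: c0; rewrite -s1E eqxx.
  have -> : s0 == 0 by rewrite eq_le s0_ge0 andbT s1E.
  by [].
split=> // l; rewrite !inE => /or3P[/eqP ->|/eqP -> //|/s1t //] s0n0.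
exfalso; move: c0; rewrite (negbTE s0n0) (gt_eqF s1_gt0) !add0n.
move=> ct; have : 0 \in t by rewrite -has_pred1 has_count ct.
by move=> /s1t; rewrite leNgt s1_gt0.
Qed.

(** The row space of L is contained in the orthogonal complement of the
    all-ones vector and has the same dimension. *)
Lemma orthogonal_ones_range e : dot ones e = 0 -> exists u, e = L *m u.
Proof.
move=> eo; have : (L <= kermx ones)%MS.
  by apply/sub_kermxP; rewrite -mulmxA incidence_const mulmx0.
move=> /mxrank_leqif_eq[_]; rewrite rank_laplacian mxrank_ker rank_ones subn1 eqxx.
move=> /esym/andP[_ kL].
have /submxP[u uE] : (e^T <= L)%MS.
  apply: submx_trans kL; apply/sub_kermxP; apply/matrixP => i j.
  by rewrite !ord1 -[LHS]/(dot e ones) dotC eo mxE.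
by exists u^T; rewrite -[e]trmxK uE trmx_mul tr_laplacian.
Qed.

Lemma algebraic_connectivity_le e : dot ones e = 0 ->
  algebraic_connectivity Q * dot e e <= dot (Q *m e) (Q *m e).
Proof.
move=> /orthogonal_ones_range[u eE]; have [/ltW a0 gap] := laplacian_gap.
have := @norm_trmul_ge _ _ _ Q^T _ u a0; rewrite trmxK; exact.
Qed.

(** A test vector: it shows that there are edges, hence blocks, and that the
    contraction rate is nonnegative. *)
Lemma exists_orthogonal_ones : exists e, dot ones e = 0 /\ e != 0.
Proof.
pose i0 := Ordinal (ltnW hV); pose i1 := Ordinal hV.
have d1 i : dot ones (delta_mx i 0) = 1.
  rewrite dotE (bigD1 i)//= big1 => [|j /negbTE ji].
    by rewrite !mxE !eqxx mulr1 addr0.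
  by rewrite !mxE ji mulr0.
exists (delta_mx i0 0 - delta_mx i1 0); split.
  by rewrite dotDr dotNr !d1 subrr.
apply/eqP => /colP /(_ i0); rewrite !mxE eqxx/= subr0 => /eqP.
by rewrite oner_eq0.
Qed.

End Laplacian.

(** * Row coverings *)

Section Covering.
Variable R : realType.

Lemma restrict_mul m k p (t : {set 'I_m}) (A : 'M[R]_(m, k)) (B : 'M[R]_(k, p)) :
  restrict t A *m B = restrict t (A *m B).
Proof. by apply/matrixP => i j; rewrite !mxE; apply: eq_bigr => l _; rewrite mxE. Qed.

Lemma dot_restrict m (t : {set 'I_m}) (v : 'cV[R]_m) :
  dot (restrict t v) (restrict t v) = \sum_(i in t) v i 0 ^+ 2.
Proof.
by rewrite dotE [RHS]big_enum_val/=; apply: eq_bigr => k _; rewrite !mxE.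
Qed.

Lemma sum_dot_restrict m d (tau : 'I_d -> {set 'I_m}) (v : 'cV[R]_m) :
  \sum_l dot (restrict (tau l) v) (restrict (tau l) v) =
  \sum_i #|[set l | i \in tau l]%SET|%:R * v i 0 ^+ 2.
Proof.
under eq_bigr => l _ do rewrite dot_restrict big_mkcond/=.
rewrite exchange_big /=; apply: eq_bigr => i _.
rewrite -big_mkcond /= sumr_const mulr_natl; congr (_ *+ _).
by apply: eq_card => l; rewrite !inE.
Qed.

Lemma bigminn_leq (I : eqType) (r : seq I) (F : I -> nat) d j : j \in r ->
  (\big[minn/d]_(i <- r) F i <= F j)%N.
Proof.
elim: r => // i r ih; rewrite inE big_cons => /orP[/eqP ->|/ih]; first exact: geq_minl.
exact/leq_trans/geq_minr.
Qed.

Variables (m n : nat) (A : 'M[R]_(m, n)) (d : nat) (tau : 'I_d -> {set 'I_m}).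
Variables (alpha beta : R) (rmin rmax : nat).
Hypothesis hT : row_covering A tau alpha beta rmin rmax.

Lemma covering_sum_ge (v : 'cV[R]_m) :
  rmin%:R * dot v v <= \sum_l dot (restrict (tau l) v) (restrict (tau l) v).
Proof.
have [_ _ _ rE _] := hT.
rewrite sum_dot_restrict dotE mulr_sumr ler_sum// => i _.
rewrite -expr2 ler_wpM2r ?sqr_ge0// ler_nat rE.
by apply: bigminn_leq; rewrite mem_index_enum.
Qed.

Lemma covering_sum_le (v : 'cV[R]_m) :
  \sum_l dot (restrict (tau l) v) (restrict (tau l) v) <= rmax%:R * dot v v.
Proof.
have [_ _ _ _ rE] := hT.
rewrite sum_dot_restrict dotE mulr_sumr ler_sum// => i _.
rewrite -expr2 ler_wpM2r ?sqr_ge0// ler_nat rE.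
exact: (leq_bigmax (F := fun i => #|[set l | i \in tau l]%SET|)).
Qed.

Lemma rmin_gt0 : (0 < d)%N -> (0 < rmin)%N.
Proof.
have [cov _ _ -> _] := hT; move=> d0.
apply: (big_ind (fun k => 0 < k)%N) => // [x y x0 y0|i _].
  by rewrite leq_min x0.
by have [l il] := cov i; rewrite card_gt0; apply/set0Pn; exists l; rewrite inE.
Qed.

Local Notation gram l := (restrict (tau l) A *m (restrict (tau l) A)^T).

Lemma covering_min l : {in spectrum (gram l), forall a, a != 0 -> alpha <= a}.
Proof.
have [_ h _ _ _] := hT; move=> a aM a0; apply: le_trans (h l) _.
exact: ge_lambda_min_pos.
Qed.

Lemma covering_max l : {in spectrum (gram l), forall a, a <= beta}.
Proof.
by have [_ _ h _ _] := hT; move=> a aM; apply: le_trans (h l); exact: le_lambda_max.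
Qed.

(** As alpha is positive, [lambda_min_pos] does not take its default value 0 and
    is a genuine eigenvalue, between alpha and beta. *)
Lemma covering_beta_gt0 : 0 < alpha -> (0 < d)%N -> 0 < beta.
Proof.
move=> a0 d0; pose l := Ordinal d0; have [_ /(_ l) h _ _ _] := hT.
have : lambda_min_pos (gram l) \in spectrum (gram l).
  have : lambda_min_pos (gram l) != 0.
    by rewrite gt_eqF// (lt_le_trans a0).
  rewrite /lambda_min_pos; case E: [seq _ <- _ | _] => [|x s]/=.
    by rewrite eqxx.
  by move=> _; have := mem_head x s; rewrite -E mem_filter => /andP[].
by move=> /covering_max; apply: lt_le_trans; exact: lt_le_trans h.
Qed.

End Covering.

(** * Iterations driven by independent uniform choices *)

Fixpoint run (S : Type) d (f : 'I_d -> S -> S) x0 (s : nat -> 'I_d) k : S :=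
  if k is k'.+1 then f (s k') (run f x0 s k') else x0.

(** Values are listed with repetitions, one for each sequence of k choices: the
    law of the k-th iterate is the uniform distribution on this list. *)
Fixpoint reach (S : Type) d (f : 'I_d -> S -> S) x0 k : seq S :=
  if k is k'.+1 then [seq f l x | x <- reach f x0 k', l <- enum 'I_d]
  else [:: x0].

Section RandomIteration.
Local Open Scope classical_set_scope.
Variables (R : realType) (disp : measure_display) (Omega : measurableType disp).
Variables (P : probability Omega R) (d : nat) (X : nat -> Omega -> 'I_d).
Hypothesis hX : iid_uniform P X.
Variables (S : Type) (f : 'I_d -> S -> S) (x0 : S).
Local Notation Y k := (fun w => run f x0 (X ^~ w) k).

(** The state space carries no sigma-algebra: since an iterate takes finitely many
    values, every set of states has a measurable preimage. *)
Lemma measurable_run k (D : set S) : measurable (Y k @^-1` D).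
Proof.
have [mX _ _] := hX; elim: k D => [|k ih] D.
  have [Dx|Dx] := pselect (D x0).
    by rewrite (_ : _ @^-1` _ = setT)//; apply/seteqP; split.
  by rewrite (_ : _ @^-1` _ = set0)//; apply/seteqP; split.
rewrite (_ : _ @^-1` _ =
  \big[setU/set0]_(l <- enum 'I_d) (X k @^-1` [set l] `&` Y k @^-1` (f l @^-1` D))).
  by apply: bigsetU_measurable => l _; exact: measurableI.
apply/seteqP; split => w /=; rewrite -bigcup_seq.
  by move=> Dw; exists (X k w) => //=; rewrite mem_enum.
by move=> [l _ /= [<-]].
Qed.

Definition cylinder (J : seq nat) (B : nat -> set 'I_d) : set Omega :=
  \bigcap_(j in [set` J]) (X j @^-1` B j).

Lemma measurable_cylinder J B : measurable (cylinder J B).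
Proof.
have [mX _ _] := hX.
by rewrite /cylinder bigcap_seq; exact: bigsetI_measurable.
Qed.

Definition refine (B : nat -> set 'I_d) k l : nat -> set 'I_d :=
  fun j => if j == k then [set l] else B j.

Lemma cylinder_cons J B k l : k \notin J ->
  cylinder (k :: J) (refine B k l) = cylinder J B `&` X k @^-1` [set l].
Proof.
move=> kJ; rewrite /cylinder !bigcap_seq big_cons setIC /refine eqxx; congr (_ `&` _).
by apply: eq_big_seq => j jJ; case: eqP => // jk; rewrite -jk jJ in kJ.
Qed.

Lemma prob_cylinder_cons J B k l : uniq J -> k \notin J ->
  (P (cylinder (k :: J) (refine B k l)) = P (cylinder J B) * (d%:R^-1)%:E)%E.
Proof.
have [_ uX iX] := hX; move=> uJ kJ.
rewrite /cylinder !iX//=; last by rewrite kJ.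
rewrite big_cons {1}/refine eqxx uX muleC; congr (_ * _)%E.
apply: eq_big_seq => j jJ; rewrite /refine.
by case: eqP => // jk; rewrite -jk jJ in kJ.
Qed.

Lemma measurable_run_fun k (g : S -> R) (D : set Omega) :
  measurable D -> measurable_fun D (EFin \o (fun w => g (Y k w))).
Proof.
move=> mD _ A mA; apply: measurableI => //.
exact: (measurable_run k (fun x => A (g x)%:E)).
Qed.

(** Splitting the cylinder according to the k-th choice l replaces g by g o f_l
    and adds the constraint X_k = l, which is why the statement is about integrals
    over cylinders that constrain choices from the k-th on only: these are
    independent of the k-th iterate. *)
Lemma integral_run k (g : S -> R) J B : (forall x, 0 <= g x) ->
  uniq J -> (forall j, j \in J -> (k <= j)%N) ->
  (\int[P]_(w in cylinder J B) (g (Y k w))%:E =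
   P (cylinder J B) * (d%:R^-1 ^+ k * \sum_(x <- reach f x0 k) g x)%R%:E)%E.
Proof.
elim: k g J B => [|k ih] g J B g0 uJ Jk /=.
  rewrite big_seq1 expr0 mul1r.
  rewrite (_ : (fun _ => _) = cst (g x0)%:E)//.
  by rewrite integral_cst; [rewrite muleC | exact: measurable_cylinder].
have kJ : k \notin J by apply/negP => /Jk; rewrite ltnn.
have Cl : cylinder J B =
    \big[setU/set0]_(l <- enum 'I_d) cylinder (k :: J) (refine B k l).
  rewrite -bigcup_seq; apply/seteqP; split => w.
    move=> wJ; exists (X k w); first by rewrite /= mem_enum.
    by rewrite cylinder_cons.
  by move=> [l _]; rewrite cylinder_cons// => -[].
rewrite {1}Cl ge0_integral_bigsetU//=; first last.
- by move=> w _; rewrite lee_fin.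
- rewrite -Cl; exact: (measurable_run_fun k.+1 g (measurable_cylinder J B)).
- apply/trivIsetP => l l' _ _ ll'; rewrite !cylinder_cons//.
  apply/seteqP; split => // w [[_ /= e1] [_ /= e2]].
  by rewrite -e1 -e2 eqxx in ll'.
- exact: enum_uniq.
- by move=> l; exact: measurable_cylinder.
transitivity (\sum_(l <- enum 'I_d) P (cylinder J B) *
   (d%:R^-1 ^+ k.+1 * \sum_(x <- reach f x0 k) g (f l x))%R%:E)%E.
  apply: eq_bigr => l _; rewrite exprS -mulrA EFinM muleA -(prob_cylinder_cons B l uJ kJ).
  rewrite -(ih (fun x => g (f l x)))//=; last 2 first.
  - by rewrite kJ.
  - by move=> j; rewrite inE => /orP[/eqP ->//|/Jk/ltnW].
  apply: eq_integral => w; rewrite inE cylinder_cons// => -[_ /= ->].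
  by [].
rewrite -ge0_sume_distrr; last first.
  move=> l _; rewrite lee_fin mulr_ge0 ?exprn_ge0 ?invr_ge0//.
  by rewrite sumr_ge0.
rewrite sumEFin -mulr_sumr big_allpairs_dep.
by rewrite exchange_big.
Qed.

Lemma expectation_run k (g : S -> R) : (forall x, 0 <= g x) ->
  ('E_P[fun w => g (Y k w)] =
   (d%:R^-1 ^+ k * \sum_(x <- reach f x0 k) g x)%R%:E)%E.
Proof.
move=> g0; rewrite unlock.
have -> : [set: Omega] = cylinder [::] (fun=> setT).
  by rewrite /cylinder bigcap_seq big_nil.
rewrite integral_run//= /cylinder bigcap_seq big_nil.
by rewrite probability_setT mul1e.
Qed.

End RandomIteration.

(** * Linear recurrences over the reachable values *)

Section Recurrence.
Variables (R : realType) (d : nat) (S : eqType) (f : 'I_d -> S -> S) (x0 : S).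

Lemma size_reach k : size (reach f x0 k) = (d ^ k)%N.
Proof.
by elim: k => //= k ih; rewrite size_allpairs ih size_enum_ord expnSr.
Qed.

Variables (inv : S -> Prop) (F : S -> R) (rho K H : R).
Hypotheses (inv0 : inv x0) (invf : forall l x, inv x -> inv (f l x)).
Hypothesis F_avg : forall x, inv x ->
  \sum_l F (f l x) <= d%:R * (rho * F x + K).
Hypotheses (rho0 : 0 <= rho) (H0 : 0 <= H) (HE : rho * H + K = H).

Lemma inv_reach k : {in reach f x0 k, forall x, inv x}.
Proof.
elim: k => [|k ih] x /=; first by rewrite inE => /eqP ->.
by move=> /allpairsP[[y l] /= [/ih yk _ ->]]; exact: invf.
Qed.

(** The average over the reachable values obeys t' <= rho t + K.  As H is the fixed
    point of this map, B_k = rho^k F x0 + H satisfies B_(k+1) = rho B_k + K. *)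
Lemma sum_reach_le k :
  \sum_(x <- reach f x0 k) F x <= d%:R ^+ k * (rho ^+ k * F x0 + H).
Proof.
elim: k => [|k ih]; first by rewrite /= big_seq1 !expr0 !mul1r lerDl.
rewrite /= big_allpairs_dep /=.
apply: le_trans (_ : \sum_(x <- reach f x0 k) d%:R * (rho * F x + K) <= _).
  rewrite big_seq [leRHS]big_seq ler_sum// => x xk.
  by rewrite big_enum /= F_avg//; exact: inv_reach xk.
rewrite -mulr_sumr big_split/= -mulr_sumr big_const_seq count_predT size_reach.
rewrite iter_addr_0 -[K *+ _]mulr_natl natrX exprS -mulrA ler_wpM2l//.
apply: le_trans (_ : rho * (d%:R ^+ k * (rho ^+ k * F x0 + H)) + d%:R ^+ k * K <= _).
  by rewrite lerD2r ler_wpM2l.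
by rewrite -{2}HE exprS le_eqVlt; apply/orP; left; apply/eqP; ring.
Qed.

End Recurrence.

(** * The block gossip iteration *)

Section Gossip.
Variables (R : realType) (V : finType) (G : graph V).
Variables (Q : 'M[R]_(#|edges G|, #|V|)).
Variables (d : nat) (tau : 'I_d -> {set 'I_#|edges G|}).
Variables (alpha beta : R) (rmin rmax : nat).
Variable mis : 'cV[R]_#|edges G|.
Hypotheses (hV : (1 < #|V|)%N) (hG : connected_graph G) (hQ : incidence_matrix Q).
Hypotheses (hT : row_covering Q tau alpha beta rmin rmax) (halpha : 0 < alpha).

Definition gossip_step l x : 'cV[R]_#|V| :=
  let A := restrict (tau l) Q in
  x + pseudoinverse A *m (restrict (tau l) mis - A *m x).

Lemma block_gossipE c s k :
  block_gossip Q mis tau c s k = run gossip_step c s k.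
Proof. by elim: k => //= k ->. Qed.

Local Notation ones := (const_mx 1 : 'cV[R]_#|V|).
Local Notation a := (algebraic_connectivity Q).
Local Notation rho := (1 - rmin%:R * a / (beta * d%:R)).
Local Notation K := (rmax%:R * dot mis mis / (alpha * d%:R)).

(** Without blocks there are no edges to cover, so that Q e = 0 for every e, against
    the connectivity bound at a nonzero e orthogonal to the all-ones vector. *)
Lemma blocks_gt0 : (0 < d)%N.
Proof.
have [e [eo e0]] := exists_orthogonal_ones R hV.
have a0 := (laplacian_gap hQ hG hV).1.
have := algebraic_connectivity_le hQ hG hV eo.
rewrite leNgt; apply: contraNltn; rewrite leqn0 => /eqP d0.
rewrite dotE big1 ?mulr_gt0// ?lt_def ?dot_eq0 ?e0 ?dot_ge0// => i _.
have [cov _ _ _ _] := hT; have [l _] := cov i.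
by have := leq_ltn_trans (leq0n _) (ltn_ord l); rewrite d0.
Qed.

Lemma mean_orthogonal (c : 'cV[R]_#|V|) : dot ones (c - const_mx (mean c)) = 0.
Proof.
rewrite dotDr dotNr !dotE.
under eq_bigr => i _ do rewrite mxE mul1r.
under [X in _ - X]eq_bigr => i _ do rewrite !mxE mul1r.
rewrite sumr_const card_ord -mulr_natr /mean divfK ?subrr//.
by rewrite pnatr_eq0 -lt0n ltnW.
Qed.

(** The all-ones vector is in the kernel of each block, hence orthogonal to each
    correction: the mean of the node values is preserved. *)
Lemma gossip_step_orthogonal l x b :
  dot ones (x - const_mx b) = 0 -> dot ones (gossip_step l x - const_mx b) = 0.
Proof.
move=> xb; rewrite /gossip_step addrAC dotDr xb add0r.
apply: dot_ker_pseudoinverse; rewrite restrict_mul incidence_const//.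
by apply/matrixP => i j; rewrite !mxE.
Qed.

Let beta0 : 0 < beta := covering_beta_gt0 hT halpha blocks_gt0.
Let d0 : 0 < d%:R :> R. Proof. by rewrite ltr0n blocks_gt0. Qed.
Let r0 : 0 < rmin%:R :> R.
Proof. by rewrite ltr0n (rmin_gt0 hT) ?blocks_gt0. Qed.
Let a0 : 0 < a := (laplacian_gap hQ hG hV).1.

(** Nonnegativity of the rate is r a <= beta d: sum |Q_tau e|^2 <= beta |e|^2 over
    the blocks and compare with r |Q e|^2 >= r a |e|^2. *)
Lemma rate_bounds : 0 <= rho < 1.
Proof.
have bd : 0 < beta * d%:R by rewrite mulr_gt0.
rewrite subr_ge0 ltrBlDr ltrDl divr_gt0 ?mulr_gt0// andbT ler_pdivrMr// mul1r.
have [e [eo e0]] := exists_orthogonal_ones R hV.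
have ee : 0 < dot e e by rewrite lt_def dot_eq0 e0 dot_ge0.
rewrite -(ler_pM2r ee) -mulrA.
apply: (le_trans (ler_wpM2l (ltW r0) (algebraic_connectivity_le hQ hG hV eo))).
apply: le_trans (covering_sum_ge hT _) _.
rewrite mulrAC mulr_natr -[d in X in _ <= X]card_ord -sumr_const.
apply: ler_sum => l _; rewrite -restrict_mul.
exact: norm_mul_le beta0 (covering_max hT (l := l)).
Qed.

(** As Q kills constants, the residual of a block depends on the error e only, and
    [projection_step_le] applies to e.  In the sum over the blocks, the row counts
    of the covering bound the two block terms. *)
Lemma gossip_average x b : dot ones (x - const_mx b) = 0 ->
  \sum_l dot (gossip_step l x - const_mx b) (gossip_step l x - const_mx b) <=
  d%:R * (rho * dot (x - const_mx b) (x - const_mx b) + K).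
Proof.
set e := x - const_mx b => eo.
apply: le_trans (_ : \sum_l (dot e e
   - beta^-1 * dot (restrict (tau l) (Q *m e)) (restrict (tau l) (Q *m e))
   + alpha^-1 * dot (restrict (tau l) mis) (restrict (tau l) mis)) <= _).
  apply: ler_sum => l _; rewrite -restrict_mul.
  have -> : gossip_step l x - const_mx b = e + pseudoinverse (restrict (tau l) Q)
      *m (restrict (tau l) mis - restrict (tau l) Q *m e).
    rewrite /gossip_step addrAC; congr (_ + _ *m (_ - _)).
    by rewrite /e !restrict_mul mulmxBr incidence_const// subr0.
  exact: projection_step_le halpha beta0
    (covering_min hT (l := l)) (covering_max hT (l := l)).
rewrite big_split/= sumrB sumr_const card_ord -!mulr_sumr.
have h1 := covering_sum_ge hT (Q *m e).
have h2 := covering_sum_le hT mis.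
have h3 := algebraic_connectivity_le hQ hG hV eo.
set s1 := \sum_l _ in h1 *; set s2 := \sum_l _ in h2 *.
have h4 : beta^-1 * (rmin%:R * (a * dot e e)) <= beta^-1 * s1.
  rewrite ler_pM2l ?invr_gt0//; apply: le_trans h1.
  by rewrite ler_wpM2l// ltW.
have h5 : alpha^-1 * s2 <= alpha^-1 * (rmax%:R * dot mis mis).
  by rewrite ler_pM2l ?invr_gt0.
have -> : d%:R * (rho * dot e e + K) =
   d%:R * dot e e - beta^-1 * (rmin%:R * (a * dot e e))
   + alpha^-1 * (rmax%:R * dot mis mis).
  by field; rewrite !gt_eqF.
rewrite -mulr_natl; lra.
Qed.

End Gossip.

Unset Implicit Arguments.
Set Strict Implicit.

Theorem corollary4p1 (R : realType) (V : finType) (G : graph V)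
    (Q : 'M[R]_(#|edges G|, #|V|))
    (d : nat) (tau : 'I_d -> {set 'I_#|edges G|})
    (alpha beta : R) (rmin rmax : nat)
    (c : 'cV[R]_#|V|) (mis : 'cV[R]_#|edges G|)
    (disp : measure_display) (Omega : measurableType disp)
    (P : probability Omega R) (X : nat -> Omega -> 'I_d)
    (hV : (1 < #|V|)%N)
    (hG : connected_graph G)
    (hQ : incidence_matrix Q)
    (hT : row_covering Q tau alpha beta rmin rmax)
    (halpha : 0 < alpha)
    (hX : iid_uniform P X) :
  let cstar : 'cV[R]_#|V| := const_mx (mean c) in
  let rho : R := 1 - rmin%:R * algebraic_connectivity Q / (beta * d%:R) in
  0 <= rho < 1 /\
  forall k : nat,
    ('E_P[fun w => (enorm (block_gossip Q mis tau c (X ^~ w) k - cstar) ^+ 2)%R]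
      <= (rho ^+ k * enorm (c - cstar) ^+ 2
          + beta * rmax%:R / (alpha * rmin%:R * algebraic_connectivity Q)
            * enorm mis ^+ 2)%R%:E)%E.
Proof.
move=> cstar rho; have rho01 : 0 <= rho < 1 := rate_bounds hV hG hQ hT halpha.
split=> // k; have d0 := blocks_gt0 hV hG hQ hT.
have beta0 := covering_beta_gt0 hT halpha d0.
have a0 := (laplacian_gap hQ hG hV).1.
have r0 := rmin_gt0 hT d0.
pose F x := dot (x - cstar) (x - cstar).
have -> : (fun w => enorm (block_gossip Q mis tau c (X ^~ w) k - cstar) ^+ 2) =
    (fun w => F (run (gossip_step Q tau mis) c (X ^~ w) k)).
  by apply/funext => w; rewrite enorm_sqr block_gossipE.
rewrite (expectation_run hX)//; last by move=> x; exact: dot_ge0.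
rewrite lee_fin exprVn ler_pdivrMl ?exprn_gt0 ?ltr0n// !enorm_sqr.
have /andP[rho0 _] := rho01.
apply: (sum_reach_le (inv := fun x => dot (const_mx 1) (x - cstar) = 0)
  (K := rmax%:R * dot mis mis / (alpha * d%:R))) => //.
- exact: mean_orthogonal.
- by move=> l x; exact: gossip_step_orthogonal.
- by move=> x; exact: gossip_average.
- by rewrite mulr_ge0 ?dot_ge0// divr_ge0 ?mulr_ge0// ltW.
- by rewrite /rho; field; rewrite !gt_eqF ?ltr0n.
Qed.
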